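(* Let $C_{15}$ be the cycle graph on $15$ vertices. Then $$\Theta(C_{15})\ \ge\ \alpha(C_{15}^{\boxtimes 4})^{1/4}\ \ge\ 2842^{1/4}\ \approx\ 7.30139 .$$
   Context: $\alpha(G)$ is the independence number of a finite simple graph $G$. $G\boxtimes H$ is the strong product: its vertex set is $V(G)\times V(H)$, and distinct $(a,x),(b,y)$ are adjacent iff ($a=b$ or $\{a,b\}\in E(G)$) and ($x=y$ or $\{x,y\}\in E(H)$); $G^{\boxtimes n}$ is the $n$-fold strong power. The Shannon capacity is $\Theta(G)=\lim_{n\to\infty}\alpha(G^{\boxtimes n})^{1/n}=\sup_n\alpha(G^{\boxtimes n})^{1/n}$. *)

(* Defs.v *)
From HB Require Import structures.
From mathcomp Require Import all_boot all_order all_algebra.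
From mathcomp Require Import all_classical all_reals all_analysis.

Set Implicit Arguments.
Unset Strict Implicit.
Unset Printing Implicit Defensive.

Import Order.TTheory GRing.Theory Num.Theory.
Import numFieldNormedType.Exports.

Local Open Scope ring_scope.

Record sgraph := SGraph {
  vertex :> finType;
  edge : rel vertex;
  edge_sym : symmetric edge;
  edge_irr : irreflexive edge }.

Section IndependenceNumber.
Variable G : sgraph.

Definition independent (S : {set G}) : bool :=
  [forall x in S, forall y in S, ~~ edge x y].

Definition alpha : nat := (\max_(S : {set G} | independent S) #|S|)%N.

End IndependenceNumber.

Section StrongProduct.
Variables G H : sgraph.

Definition strong_edge : rel (G * H) := fun p q =>
  [&& p != q, (p.1 == q.1) || edge p.1 q.1 & (p.2 == q.2) || edge p.2 q.2].

Lemma strong_edge_sym : symmetric strong_edge.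
Proof.
move=> p q; rewrite /strong_edge eq_sym (eq_sym p.1) (eq_sym p.2).
by rewrite (edge_sym p.1) (edge_sym p.2).
Qed.

Lemma strong_edge_irr : irreflexive strong_edge.
Proof. by move=> p; rewrite /strong_edge eqxx. Qed.

Definition strong_prod : sgraph := SGraph strong_edge_sym strong_edge_irr.

End StrongProduct.

Definition one_vertex_graph : sgraph :=
  @SGraph unit (fun _ _ => false) (fun _ _ => erefl) (fun _ => erefl).

Definition strong_pow (G : sgraph) (n : nat) : sgraph :=
  iter n (strong_prod G) one_vertex_graph.

Section CycleGraph.
Variable n : nat.

(* [ordS i] is [i + 1] modulo [n]. The first conjunct matters only for [n = 1],
   where it removes the loop. *)
Definition cycle_edge : rel 'I_n := fun i j =>
  (i != j) && ((j == ordS i) || (i == ordS j)).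

Lemma cycle_edge_sym : symmetric cycle_edge.
Proof. by move=> i j; rewrite /cycle_edge eq_sym orbC. Qed.

Lemma cycle_edge_irr : irreflexive cycle_edge.
Proof. by move=> i; rewrite /cycle_edge eqxx. Qed.

Definition cycle_graph : sgraph := SGraph cycle_edge_sym cycle_edge_irr.

End CycleGraph.

Section ShannonCapacity.
Variables (R : realType) (G : sgraph).

Definition alpha_root (n : nat) : R :=
  (alpha (strong_pow G n))%:R `^ (n%:R)^-1.

Definition shannon_capacity : R := limn alpha_root.

End ShannonCapacity.

(* The limit defining [shannon_capacity] exists and is the supremum over
   [n >= 1] (Fekete's lemma). *)

Definition near_eq (G : sgraph) (x y : G) : bool := (x == y) || edge x y.

Lemma near_eq_prod (G H : sgraph) (p q : strong_prod G H) :
  near_eq p q = near_eq p.1 q.1 && near_eq p.2 q.2.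
Proof.
case: p q => [a x] [b y]; rewrite /near_eq /= /strong_edge /= xpair_eqE.
by case: eqVneq => _; case: eqVneq => _; rewrite //= ?orbT ?andbT.
Qed.

Lemma independentP (G : sgraph) (S : {set G}) :
  reflect {in S &, forall x y, near_eq x y -> x = y} (independent S).
Proof.
apply: (iffP forall_inP) => [indS x y xS yS | indS x xS].
  by case/orP => [/eqP //|exy]; have /forall_inP/(_ y yS) := indS x xS; rewrite exy.
apply/forall_inP => y yS; apply/negP => exy.
have xy : x = y by apply: indS; rewrite // /near_eq exy orbT.
by move: exy; rewrite xy edge_irr.
Qed.

Lemma leq_alpha (G : sgraph) (S : {set G}) : independent S -> (#|S| <= alpha G)%N.
Proof. by move=> indS; apply: leq_bigmax_cond. Qed.

Lemma alpha_witness (G : sgraph) : exists2 S : {set G}, independent S & #|S| = alpha G.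
Proof.
have ind0 : independent (@finset.set0 G).
  by apply/independentP => x y; rewrite inE.
by have [|S] := @eq_bigmax_cond _ [pred S : {set G} | independent S] (fun S => #|S|);
  [apply/card_gt0P; exists (@finset.set0 G) | exists S].
Qed.

Lemma alpha_leq_card (G : sgraph) : (alpha G <= #|G|)%N.
Proof. by apply/bigmax_leqP => S _; apply: max_card. Qed.

Lemma alpha_gt0 (G : sgraph) : (0 < #|G|)%N -> (0 < alpha G)%N.
Proof.
case/card_gt0P => x _; rewrite -(cards1 x); apply: leq_alpha.
by apply/independentP => y z /set1P -> /set1P ->.
Qed.

Lemma alpha_strong_prod (G H : sgraph) :
  (alpha G * alpha H <= alpha (strong_prod G H))%N.
Proof.
have [S indS <-] := alpha_witness G; have [T indT <-] := alpha_witness H.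
rewrite -cardsX; apply: (@leq_alpha (strong_prod G H)).
apply/independentP => -[a x] [b y]; rewrite !inE => /andP[/= aS xT] /andP[/= bS yT].
rewrite near_eq_prod /= => /andP[ab xy].
by congr pair; [apply: (independentP _ indS) | apply: (independentP _ indT)].
Qed.

Lemma leq_alpha_embed (G H : sgraph) (f : G -> H) :
  injective f -> (forall x y, near_eq (f x) (f y) -> near_eq x y) ->
  (alpha G <= alpha H)%N.
Proof.
move=> injf fE; have [S indS <-] := alpha_witness G.
rewrite -(card_imset S injf); apply: leq_alpha; apply/independentP.
move=> _ _ /imsetP[x xS ->] /imsetP[y yS ->] /fE xy.
by congr f; apply: (independentP _ indS).
Qed.

Fixpoint pow_cat (G : sgraph) (m n : nat) :
    strong_pow G m -> strong_pow G n -> strong_pow G (m + n) :=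
  match m with
  | 0 => fun _ y => y
  | m'.+1 => fun p y => (p.1, @pow_cat G m' n p.2 y)
  end.

Lemma near_eq_pow_cat (G : sgraph) m n (x x' : strong_pow G m) (y y' : strong_pow G n) :
  near_eq (pow_cat x y) (pow_cat x' y') = near_eq x x' && near_eq y y'.
Proof.
elim: m x x' => [[] []|m IHm x x'] //=.
by rewrite !(@near_eq_prod G) /= IHm andbA.
Qed.

Lemma pow_cat_inj (G : sgraph) m n (x x' : strong_pow G m) (y y' : strong_pow G n) :
  pow_cat x y = pow_cat x' y' -> (x, y) = (x', y').
Proof.
elim: m x x' => [[] [] /= ->|m IHm [a x] [a' x']] //=.
by case=> <- /IHm[<- <-].
Qed.

Lemma alpha_strong_powD (G : sgraph) m n :
  (alpha (strong_pow G m) * alpha (strong_pow G n)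
     <= alpha (strong_pow G (m + n)))%N.
Proof.
apply: leq_trans (alpha_strong_prod _ _) _.
apply: (@leq_alpha_embed _ _ (fun p : strong_prod _ _ => pow_cat p.1 p.2)).
  by move=> [x y] [x' y'] /pow_cat_inj.
by move=> p q; rewrite near_eq_pow_cat near_eq_prod.
Qed.

Lemma alpha_strong_powM (G : sgraph) m q :
  (alpha (strong_pow G m) ^ q <= alpha (strong_pow G (q * m)))%N.
Proof.
elim: q => [|q IHq]; first by rewrite expn0 mul0n alpha_gt0 // card_unit.
rewrite expnS mulSn; apply: leq_trans (alpha_strong_powD _ _ _).
by rewrite leq_mul2l IHq orbT.
Qed.

Lemma card_strong_pow (G : sgraph) n : #|strong_pow G n| = (#|G| ^ n)%N.
Proof. by elim: n => [|n IHn]; rewrite ?card_unit // card_prod IHn expnS. Qed.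

Section Fekete.
Variables (R : realType) (G : sgraph).

Local Notation u := (@alpha_root R G).
Local Notation range_u := [set u n | n in [set n | (0 < n)%N]]%classic.

Lemma alpha_root_le n : (0 < n)%N -> u n <= #|G|%:R.
Proof.
move=> n0; rewrite /alpha_root.
have -> : #|G|%:R = ((#|G| ^ n)%:R : R) `^ (n%:R)^-1.
  rewrite natrX -powR_mulrn ?ler0n // -powRrM mulfV ?powRr1 //.
  by rewrite pnatr_eq0 -lt0n.
apply: ge0_ler_powR; rewrite ?invr_ge0 ?nnegrE ?ler0n ?ler_nat //.
by rewrite -card_strong_pow alpha_leq_card.
Qed.

Lemma has_sup_alpha_root : has_sup range_u.
Proof.
split; first by exists (u 1); exists 1%N.
by exists #|G|%:R => _ [n n0 <-]; apply: alpha_root_le.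
Qed.

Lemma alpha_root_lower m n : (0 < #|G|)%N -> (0 < m)%N -> (0 < n)%N ->
  u m / (alpha (strong_pow G m))%:R `^ (n%:R)^-1 <= u n.
Proof.
move=> G0 m0 n0; set a := alpha _.
have a0 k : (0 < alpha (strong_pow G k))%N.
  by rewrite alpha_gt0 // card_strong_pow expn_gt0 G0.
have aR : (a%:R : R) != 0 by rewrite pnatr_eq0 -lt0n a0.
have a1 : 1 <= (a%:R : R) by rewrite ler1n a0.
have nR : (n%:R : R) != 0 by rewrite pnatr_eq0 -lt0n.
have mR : (m%:R : R) != 0 by rewrite pnatr_eq0 -lt0n.
have le1 : (a%:R : R) ^+ (n %/ m) <= (alpha (strong_pow G n))%:R.
  rewrite -natrX ler_nat; apply: leq_trans (alpha_strong_powM G m (n %/ m)) _.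
  rewrite {2}(divn_eq n m); apply: leq_trans (alpha_strong_powD _ _ _).
  by rewrite leq_pmulr.
have le2 : ((a%:R : R) ^+ (n %/ m)) `^ (n%:R)^-1 <= u n.
  by apply: ge0_ler_powR le1; rewrite ?invr_ge0 ?nnegrE ?exprn_ge0 ?ler0n.
apply: le_trans le2; rewrite -powR_mulrn ?ler0n // -powRrM.
rewrite /alpha_root -/a -powRB ?aR ?implybT //; apply: ler_powR => //.
rewrite ler_pdivlMr ?ltr0n // mulrBl mulVf // lerBlDr.
rewrite mulrC ler_pdivrMr ?ltr0n // natr1 -natrM ler_nat.
by rewrite ltnW // ltn_ceil.
Qed.

Lemma cvg_alpha_root : (u @ \oo --> sup range_u)%classic.
Proof.
have [u_ne u_ub] := has_sup_alpha_root.
have ule n : (0 < n)%N -> u n <= sup range_u.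
  by move=> n0; apply: ub_le_sup => //; exists n.
have [G0|] := posnP #|G|.
  have uE n : (0 < n)%N -> u n = 0.
    move=> n0; apply/le_anti; rewrite powR_ge0 andbT.
    by have := alpha_root_le n0; rewrite G0.
  have -> : sup range_u = 0.
    apply/le_anti/andP; split; last by rewrite -(uE 1%N) // ule.
    by apply: ge_sup => // _ [n n0 <-]; rewrite uE.
  apply: (cvg_near_cst _).
  by near=> n; apply: uE; near: n; exists 1%N.
move=> G0; apply/cvgrPdist_le => /= e e0.
have [_ [m m0 <-] um] := sup_adherent (divr_gt0 e0 (ltr0n R 2)) has_sup_alpha_root.
pose c : R := (alpha (strong_pow G m))%:R.
have c0 : 0 < c by rewrite ltr0n alpha_gt0 // card_strong_pow expn_gt0 G0.
have cvg0 : ((fun n : nat => (n%:R)^-1 * ln c) @ \oo --> (0 * ln c : R))%classic.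
  apply: cvgM; last exact: cvg_cst.
  by rewrite -cvg_shiftS; exact: cvg_harmonic.
have cvg1 : ((fun n : nat => c `^ (n%:R)^-1) @ \oo --> (1 : R))%classic.
  have -> : (fun n : nat => c `^ (n%:R)^-1) = (fun n : nat => expR ((n%:R)^-1 * ln c)).
    by apply/funext => n; rewrite /powR gt_eqF.
  rewrite [X in (_ --> X)%classic](_ : _ = expR (0 * ln c)); last by rewrite mul0r expR0.
  exact: (cvg_comp _ _ cvg0 (@continuous_expR R _)).
have cvgc : ((fun n : nat => u m / c `^ (n%:R)^-1) @ \oo --> u m)%classic.
  rewrite -[X in (_ --> X)%classic]divr1; apply: cvgM; first exact: cvg_cst.
  by apply: (cvgV (oner_neq0 _)); exact: cvg1.
have near_m : (\forall n \near \oo, u m - e / 2 < u m / c `^ (n%:R)^-1)%classic.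
  by apply: cvgr_gt cvgc _ _; rewrite ltrBlDr ltrDl divr_gt0.
near=> n.
have n0 : (0 < n)%N by near: n; exists 1%N.
rewrite ger0_norm ?subr_ge0 ?ule // lerBlDr -lerBlDl.
apply: le_trans (alpha_root_lower G0 m0 n0).
apply: ltW; apply: lt_trans (_ : u m - e / 2 < _); last by near: n.
by rewrite ltrBrDr; apply: le_lt_trans um; rewrite [X in _ - X]splitr opprD addrA subrK.
Unshelve. all: by end_near. Qed.

Lemma shannon_capacity_sup : shannon_capacity R G = sup range_u.
Proof. exact: cvg_lim cvg_alpha_root. Qed.

End Fekete.

(* Main.v *)
Require Import Defs.
From mathcomp Require Import all_boot all_order all_algebra.
From mathcomp Require Import all_classical all_reals all_analysis.
From mathcomp Require Import lra.
From Stdlib Require BinNat.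
Import Order.TTheory GRing.Theory Num.Theory.
Local Open Scope ring_scope.

(** The capacity is a supremum of the numbers alpha(C_15^k)^(1/k), so everything
    rests on an explicit independent set of 2842 vertices in C_15^4. It is a
    cyclic orbit, rounded to the grid after the removal of 31 of its points.

    Put p = 2873 and g = (166, 2490, 8, 5), and consider in the torus (R/15Z)^4
    the p points 15 t g / p, for t in Z_p. If any two of them were at distance at
    least 2 in some coordinate, rounding all coordinates down would give p
    pairwise non-adjacent vertices. This almost holds: the only offending
    differences are t = 1, 15, 16, 1125, 1800 and their opposites. For the last
    four, the decisive coordinate is respectively

      383 * 15/p, 382 * 15/p, 381 * 15/p, 381 * 15/p,

    slightly less than 2. So, instead of rounding, let the i-th coordinate be a
    walk around C_15 along the sequence 0, d_i, 2 d_i, ... of Z_p, where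
    d = (-15, -16, 1125, 1800), which advances by 2 cells at each step. The p
    steps advance by 2 p in total, and

      2 p = 15 * 383 + 1 = 15 * 382 + 16 = 15 * 381 + 31,

    so the walks close up, with the winding numbers 383, 382, 381, 381 of the
    orbit, if they advance by 1 only at 1, 16, 31, 31 of their steps.
    A walk slipping in this way when it reaches t spoils the pair (t - d_i, t),
    so t is removed. The same 31 points can serve for all four walks: take the
    intervals 0..15 and 191..205, with slips of the first walk at 0, of the
    second on the first interval, and of the other two on both. These slips are
    spread nearly evenly along each walk (about 180 steps apart for the second,
    and 79 to 143 for the last two), so that no walk drifts far from the orbit,
    and the pairs of points that were far apart remain so. The difference 1 takes
    care of itself: t -> t + 1 carries the slips of the second walk to one
    another, but for the ends of their interval, so that this walk moves back by
    exactly 2 cells from each remaining t to t + 1. There remain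
    2873 - 31 = 2842 points, and [words_packed] checks their independence.

    The check is a divide and conquer: two vertices of a strong power are equal
    or adjacent iff in each coordinate they share an edge of the cycle, so it
    suffices to split the set, coordinate by coordinate, according to the edges
    of the cycle, and to see that at most one vertex is left in each part
    ([leq_size_alpha_packed]). *)

Section Packing.
Set Implicit Arguments.
Unset Strict Implicit.
Local Open Scope nat_scope.

Definition on_edge (n i : nat) : pred (seq nat) :=
  let j := i.+1 %% n in fun w => (head 0 w == i) || (head 0 w == j).

(** Equivalently, the cubes of side 2 with corners at the words of [s] are
    disjoint in the torus (Z/nZ)^d. Splitting the list at each coordinate makes
    the cost proportional to [n * 2 ^ d * size s] and not to the number of
    pairs. *)
Fixpoint packed (n d : nat) (s : seq (seq nat)) : bool :=
  if d is d'.+1 then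
    all (fun i => packed n d' [seq behead w | w <- s & on_edge n i w]) (iota 0 n)
  else size s <= 1.

Fixpoint vertex_of (n d : nat) (w : seq nat) : strong_pow (cycle_graph n.+1) d :=
  match d with
  | 0 => tt
  | d'.+1 => (inord (head 0 w) : cycle_graph n.+1, vertex_of n d' (behead w))
  end.

Definition apart (n d : nat) : rel (seq nat) :=
  fun v w => ~~ near_eq (vertex_of n d v) (vertex_of n d w).

(** Both ends of the edge number [i] satisfy [on_edge n.+1 i], so a single [i]
    witnesses equality and both orientations of adjacency. *)
Lemma near_on_edge (n : nat) (v w : seq nat) :
  head 0 v <= n -> head 0 w <= n ->
  near_eq (inord (head 0 v) : cycle_graph n.+1) (inord (head 0 w)) ->
  exists2 i, i < n.+1 & on_edge n.+1 i v && on_edge n.+1 i w.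
Proof.
move=> vn wn; rewrite /near_eq /on_edge /= /cycle_edge.
case/orP => [/eqP/(congr1 val)|/andP[_ /orP[]/eqP/(congr1 val)]].
- by rewrite /= !inordK // => ->; exists (head 0 w); rewrite ?eqxx.
- by rewrite /= !inordK // => ->; exists (head 0 v); rewrite ?eqxx ?orbT.
- by rewrite /= !inordK // => ->; exists (head 0 w); rewrite ?eqxx ?orbT.
Qed.

(** A pairwise property can be tested on a family of overlapping parts, as soon
    as each pair that could violate it lies within one of the parts. *)
Lemma pairwise_cover (T : Type) (I : Type) (P : I -> Prop) (a : I -> pred T)
    (b : pred T) (r r' : rel T) (s : seq T) :
  all b s ->
  (forall x y, b x -> b y -> ~~ r' x y -> ~~ r x y /\ exists2 i, P i & a i x && a i y) ->
  (forall i, P i -> pairwise r [seq x <- s | a i x]) ->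
  pairwise r' s.
Proof.
move=> + cov; elim: s => //= x s IHs /andP[bx bs] rs; apply/andP; split; last first.
  by apply: IHs => // i Pi; have := rs i Pi; case: ifP => //= _ /andP[].
elim: s {IHs} bs rs => //= y s IHs /andP[by_ bs] rs; apply/andP; split; last first.
  apply: IHs => // i Pi; have := rs i Pi.
  case: (a i x); case: (a i y) => //=; first by case/andP => /andP[_ ->] /andP[].
  by case/andP.
apply/negPn/negP => /(cov _ _ bx by_)[/negP nr [i Pi /andP[ax ay]]].
by have := rs i Pi; rewrite ax ay /= => /andP[/andP[]].
Qed.

Lemma packed_apart (n d : nat) (s : seq (seq nat)) :
  all (all (leq^~ n)) s -> packed n.+1 d s -> pairwise (apart n d) s.
Proof.
elim: d s => [|d IHd] s bs; first by case: s {bs} => [|x []].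
move=> /allP ps; apply: (pairwise_cover bs (P := fun i => i < n.+1)
  (a := on_edge n.+1) (r := fun v w => apart n d (behead v) (behead w))).
  have le_head w : all (leq^~ n) w -> head 0 w <= n by case: w => //= x w /andP[].
  move=> v w /le_head vn /le_head wn; rewrite /apart !negbK near_eq_prod /=.
  by case/andP => /(near_on_edge vn wn).
move=> i lt_in; rewrite -(pairwise_map behead); apply: IHd; last first.
  by apply: ps; rewrite mem_iota.
rewrite all_map; apply: sub_all (_ : all (all (leq^~ n)) _).
  by case=> //= x w /andP[].
by rewrite all_filter; apply: sub_all bs => w /= ->; rewrite implybT.
Qed.

(** As [near_eq] is reflexive, words that are apart give distinct vertices, so
    the length of the list is the number of its vertices. *)
Lemma leq_size_alpha_packed (n d : nat) (s : seq (seq nat)) :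
  all (all (leq^~ n)) s -> packed n.+1 d s ->
  size s <= alpha (strong_pow (cycle_graph n.+1) d).
Proof.
set G := strong_pow _ _ => bs /(packed_apart bs).
rewrite -(pairwise_map (vertex_of n d) (fun x y : G => ~~ near_eq x y)).
rewrite -(size_map (vertex_of n d)).
move: (map _ _) => {bs}s ap.
have near_refl (x : G) : near_eq x x by rewrite /near_eq eqxx.
have /card_uniqP <- : uniq s.
  by apply: pairwise_uniq ap => x; rewrite /= near_refl.
rewrite -cardsE; apply: leq_alpha; apply/independentP => x y.
rewrite !inE => xs ys near_xy; apply/eqP; move: xs ys near_xy.
have near_sym (u v : G) : near_eq u v = near_eq v u.
  by rewrite /near_eq eq_sym edge_sym.
elim: s ap => //= z s IHs /andP[/allP zs /IHs IH]; rewrite !inE.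
case/predU1P => [->|xs] /predU1P[->|ys] near_xy; rewrite ?eqxx ?IH //.
  by have := zs _ ys; rewrite /= near_xy.
by have := zs _ xs; rewrite /= near_sym near_xy.
Qed.

End Packing.

Section Construction.
Import BinNums BinNat.
Local Open Scope nat_scope.

Local Notation p := 2873%num.

(** The points where the walks slip, which are those removed from the orbit; the
    16 slips of the second walk come first. *)
Definition slips_both : seq N := [seq N.of_nat r | r <- iota 0 16 ++ iota 191 15].

Definition survivors : seq N := [seq N.of_nat t | t <- iota 16 175 ++ iota 206 2667].

(** The rank of [t] in the sequence 0, d, 2 d, ... of Z_p, for [e] the inverse of
    [d] modulo p. *)
Definition position (e t : N) : N := N.modulo (N.mul t e) p.

(** The walk has made [k] steps of 2 cells, and lost one cell at each of the
    slips already met. The subtraction does not truncate at the survivors, where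
    [0 < k]. The slips are located outside of the function of [t], so that this
    is computed once. *)
Definition cell (e : N) (D : seq N) : N -> nat :=
  let slips := [seq position e r | r <- D] in fun t =>
  let k := position e t in
  N.to_nat (N.modulo (N.sub (N.double k) (N.of_nat (count (N.leb^~ k) slips))) 15).

(** 383, 1616, 1757, 739 are the inverses of -15, -16, 1125, 1800 modulo p. *)
Definition words : seq (seq nat) :=
  let c1 := cell 383 (take 1 slips_both) in
  let c2 := cell 1616 (take 16 slips_both) in
  let c3 := cell 1757 slips_both in
  let c4 := cell 739 slips_both in
  [seq [:: c1 t; c2 t; c3 t; c4 t] | t <- survivors].

Lemma words_bounded : all (all (leq^~ 14)) words.
Proof. by vm_compute. Qed.

Lemma words_packed : packed 15 4 words.
Proof. by vm_compute. Qed.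

Lemma leq_alpha_C15_4 : 2842 <= alpha (strong_pow (cycle_graph 15) 4).
Proof.
have -> : 2842 = size words by rewrite size_map; vm_compute.
exact: leq_size_alpha_packed words_bounded words_packed.
Qed.

End Construction.

(** Comparing with a power avoids real exponents, and leaves rational
    arithmetic. *)
Lemma le_powR_inv (R : realType) (n : nat) (c y : R) :
  0 <= c -> 0 <= y -> (y <= c `^ n.+1%:R^-1) = (y ^+ n.+1 <= c).
Proof.
move=> c0 y0; have rootK : (c `^ n.+1%:R^-1) ^+ n.+1 = c.
  by rewrite -powR_mulrn ?powR_ge0 // -powRrM mulVf ?powRr1 // pnatr_eq0.
by rewrite -[in RHS]rootK ler_pXn2r // nnegrE ?powR_ge0.
Qed.

Theorem theorem1p6 (R : realType) :
  [/\ (alpha (strong_pow (cycle_graph 15) 4))%:R `^ 4^-1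
        <= shannon_capacity R (cycle_graph 15),
      2842 `^ 4^-1 <= (alpha (strong_pow (cycle_graph 15) 4))%:R `^ 4^-1 :> R
    & 7 + 301 / 10 ^+ 3 + 39 / 10 ^+ 5 <= (2842 : R) `^ 4^-1
        < 7 + 301 / 10 ^+ 3 + 40 / 10 ^+ 5].
Proof.
split.
- rewrite shannon_capacity_sup; have [_ ub] := has_sup_alpha_root R (cycle_graph 15).
  by apply: ub_le_sup => //; exists 4%N.
- apply: ge0_ler_powR; rewrite ?invr_ge0 ?nnegrE ?ler0n ?ler_nat //.
  exact: leq_alpha_C15_4.
- by rewrite ltNge !(@le_powR_inv _ 3); lra.
Qed.
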